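(* Let $a_1,a_2,a_3,b_1,b_2,b_3\in\mathbb{R}$ and let $$J=\begin{bmatrix} a_1 & b_1 & 0 \\ 0 & a_2 & b_2 \\ b_3 & 0 & a_3 \end{bmatrix}.$$ Assume that $a_1a_2+a_1a_3+a_2a_3>0$, and normalise $t$ so that there is a Hopf bifurcation with $a_1a_2+a_1a_3+a_2a_3=1$ (so that the eigenvalues of $J$ are $a_1+a_2+a_3$, $\mathrm{i}$ and $-\mathrm{i}$). Let $\phi(t)=[\phi_1(t),\phi_2(t),\phi_3(t)]^{\mathrm T}$ be the linearised eigenfunction for the eigenvalue $\mathrm{i}$. Then, taking $j\pmod 3$, the phase shift $\theta_j$ from $\phi_j(t)$ to $\phi_{j+1}(t)$ is $$\theta_j=2\pi-\arg\left(\frac{\mathrm{i}-a_j}{b_j}\right)\pmod{2\pi},\qquad j=1,2,3.$$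
   Context: $J$ is the Jacobian at an equilibrium of an admissible ODE $\dot x_1=f_1(x_1,x_2)$, $\dot x_2=f_2(x_2,x_3)$, $\dot x_3=f_3(x_3,x_1)$, $x_j\in\mathbb{R}$, for the 3-node fully inhomogeneous unidirectional ring. Indices are read mod $3$ with $0$ replaced by $3$, so $\phi_4=\phi_1$. If $\mathrm{i}$ is an eigenvalue of $J$ then every $b_j$ is nonzero, so the quotients make sense. The linearised eigenfunction is $\phi(t)=e^{\mathrm{i}t}u$ where $u=[u_1,u_2,u_3]^{\mathrm T}\in\mathbb{C}^3$ is an eigenvector of $J$ for the eigenvalue $\mathrm{i}$. The argument $\arg z$ of a nonzero complex number is taken in $[0,2\pi)$. Phase shifts are elements of $\mathbb{R}/2\pi\mathbb{Z}$: for a $2\pi$-periodic $\rho$, the phase shift from $\rho(t)$ to $\rho(t-\theta)$ is $\theta$, and amplitudes are ignored, so the phase shift from $\phi_j$ to $\phi_k$ is the $\theta$ for which $\phi_k(t)=r\,\phi_j(t-\theta)$ for all $t$ with some $r>0$. *)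

(* Defs.v *)
From mathcomp Require Import all_boot all_order all_algebra.
From mathcomp Require Import complex.
From mathcomp Require Import boolp classical_sets reals trigo.
From mathcomp Require Import lra.
Set Implicit Arguments.
Unset Strict Implicit.
Unset Printing Implicit Defensive.
Import Order.TTheory GRing.Theory Num.Theory.
Local Open Scope ring_scope.
Local Open Scope complex_scope.

(* e^(i t) for real t. *)
Definition expi (R : realType) (t : R) : R[i] := cos t +i* sin t.

(* Existence of this angle for z != 0 is [argCP] below, and uniqueness is
   [argC_uniq]; the value of [argC 0] is irrelevant. *)
Definition argC (R : realType) (z : R[i]) : R :=
  xget 0 [set t : R | 0 <= t < 2 * pi /\ z = `|z| * expi t]%classic.

Definition eqmod2pi (R : realType) (x y : R) : Prop :=
  exists k : int, x = y + k%:~R * (2 * pi).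

(* The indices 1, 2, 3 are encoded as 0, 1, 2 in 'I_3 = Z/3Z, whose addition
   is modulo 3, so that j + 1 is the cyclic successor of j. *)
Definition ring_jacobian (R : pzRingType) (a b : 'I_3 -> R) : 'M[R]_3 :=
  \matrix_(j, k) (if k == j then a j else if k == j + 1 then b j else 0).

Definition complexify (R : rcfType) m n (A : 'M[R]_(m, n)) : 'M[R[i]]_(m, n) :=
  map_mx (real_complex R) A.

Definition hopf_spectrum (R : rcfType) n (A : 'M[R]_n) : Prop :=
  exists2 w : R, w != 0 & eigenvalue (complexify A) (0 +i* w).

(* Column eigenvectors: mathcomp's [eigenvalue] and [eigenspace] are phrased
   with row vectors, which gives the same eigenvalues but not the same
   eigenvectors. *)
Definition is_eigenvector (F : fieldType) n (A : 'M[F]_n) (l : F)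
    (u : 'cV[F]_n) : Prop :=
  u != 0 /\ A *m u = l *: u.

Definition eigenfunction (R : realType) n (u : 'cV[R[i]]_n) (j : 'I_n) (t : R) :
    R[i] :=
  expi t * u j 0.

(* Taking f(t - theta): a positive theta is a delay of g relative to f; the
   amplitude r is ignored. *)
Definition is_phase_shift (R : realType) (f g : R -> R[i]) (theta : R) : Prop :=
  exists2 r : R, 0 < r & forall t : R, g t = r%:C * f (t - theta).

Lemma argCP (R : realType) (z : R[i]) : z != 0 ->
  0 <= argC z < 2 * pi /\ z = `|z| * expi (argC z).
Proof.
move=> z0; suff: exists t : R, 0 <= t < 2 * pi /\ z = `|z| * expi t.
  by move/xgetPex => /(_ 0).
have pi0 := pi_gt0 R.
case: z z0 => x y z0; rewrite normc_def /=.
set n := Num.sqrt _.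
have n0 : 0 < n.
  rewrite sqrtr_gt0 lt_def addr_ge0 ?sqr_ge0 // andbT.
  rewrite paddr_eq0 ?sqr_ge0 // !sqrf_eq0.
  by apply: contra z0 => /andP[/eqP-> /eqP->].
have nn : n != 0 by rewrite gt_eqF.
have n2 : n ^+ 2 = x ^+ 2 + y ^+ 2 by rewrite sqr_sqrtr // addr_ge0 ?sqr_ge0.
pose c := x / n.
have c2 : 1 - c ^+ 2 = (y / n) ^+ 2.
  by rewrite !expr_div_n -[1](@divff _ (n ^+ 2)) ?expf_neq0 // -mulrBl n2 addrC addKr.
have cI : -1 <= c <= 1.
  by rewrite -ler_norml -(@expr_le1 _ 2) // real_normK ?num_real // -subr_ge0 c2 sqr_ge0.
have sa : sin (acos c) = `|y / n| by rewrite sin_acos // c2 sqrtr_sqr.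
have ca : cos (acos c) = c by rewrite acosK // in_itv.
have /andP[a0 a1] : 0 <= acos c <= pi by rewrite acos_ge0 // acos_lepi.
have mulE (p q : R) : n%:C * (p +i* q) = (n * p) +i* (n * q).
  by apply/eqP; rewrite eq_complex /=; apply/andP; split; apply/eqP; lra.
have [y0|y0] := leP 0 y.
  exists (acos c); split; first by rewrite a0 /=; lra.
  rewrite /expi mulE ca sa ger0_norm ?divr_ge0 // ?ltW //.
  by rewrite /c ![n * _]mulrC !divfK.
exists (2 * pi - acos c).
have yn : y / n < 0 by rewrite pmulr_llt0 // invr_gt0.
have ap : 0 < acos c.
  rewrite lt_neqAle a0 andbT eq_sym; apply/eqP => E.
  by move: sa; rewrite E sin0 ltr0_norm //; lra.
split; first by apply/andP; split; lra.
rewrite /expi mulE.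
have -> : 2 * pi - acos c = - acos c + pi *+ 2 by rewrite -mulr_natl; lra.
rewrite cosD2pi sinD2pi cosN sinN ca sa.
by rewrite ltr0_norm // opprK /c ![n * _]mulrC !divfK.
Qed.

Lemma argC_uniq (R : realType) (z : R[i]) (t : R) : z != 0 ->
  0 <= t < 2 * pi -> z = `|z| * expi t -> argC z = t.
Proof.
move=> z0 /andP[t0 t1] zt; have [/andP[s0 s1] zs] := argCP z0.
have E : expi (argC z) = expi t.
  by apply: (@mulfI _ `|z|); rewrite ?normr_eq0 // -zs -zt.
case: E => Ec Es; set s := argC z in s0 s1 Ec Es *.
have pi0 := pi_gt0 R.
have cd : cos (s - t) = 1.
  by rewrite cosB Ec Es -!expr2 cos2Dsin2.
have h : sin ((s - t) / 2) = 0.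
  have := cos2Dsin2 ((s - t) / 2).
  have : cos (s - t) = cos ((s - t) / 2) ^+ 2 - sin ((s - t) / 2) ^+ 2.
    by rewrite [in LHS](_ : s - t = (s - t) / 2 + (s - t) / 2) ?cosD ?expr2; lra.
  rewrite cd => e1 e2; apply/eqP; rewrite -sqrf_eq0; apply/eqP; lra.
case: (ltrgtP s t) => // lt_st.
  have : 0 < sin ((t - s) / 2) by apply: sin_gt0_pi; apply/andP; split; lra.
  by rewrite (_ : (t - s) / 2 = - ((s - t) / 2)) ?sinN ?h ?oppr0 ?ltxx //; lra.
have : 0 < sin ((s - t) / 2) by apply: sin_gt0_pi; apply/andP; split; lra.
by rewrite h ltxx.
Qed.

(* Main.v *)
(* The characteristic polynomial is [(X - a0)(X - a1)(X - a2) - b0 b1 b2]; under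
   the normalisation a purely imaginary root [i w] forces [w^2 = 1] and
   [a0 a1 a2 + b0 b1 b2 = a0 + a1 + a2], which gives the spectrum. If some [b j]
   vanished, the roots would be the real numbers [a j]. Row [j] of [J u = i u]
   reads [u (j + 1) = c u j] with [c = (i - a j) / b j], and multiplying
   [e^(i t)] by [c = |c| e^(i arg c)] rescales it by [|c|] and delays it by
   [- arg c]. *)
Require Import Defs.
From mathcomp Require Import all_boot all_order all_algebra.
From mathcomp Require Import complex ring lra.
From mathcomp Require Import boolp classical_sets reals trigo.
Import Order.TTheory GRing.Theory Num.Theory.
Local Open Scope ring_scope.
Local Open Scope complex_scope.

Lemma forall_ord3 (P : 'I_3 -> Prop) : P 0 -> P 1 -> P 2 -> forall j, P j.
Proof.
move=> P0 P1 P2 [[|[|[|//]]] lt_j3].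
- by rewrite (_ : Ordinal _ = 0) //; apply: val_inj.
- by rewrite (_ : Ordinal _ = 1) //; apply: val_inj.
- by rewrite (_ : Ordinal _ = 2) //; apply: val_inj.
Qed.

(** The cyclic successor acts transitively, so a zero coordinate will spread to the whole
    eigenvector. *)
Lemma ord3_cases (j k : 'I_3) : [|| k == j, k == j + 1 | k == j + 1 + 1].
Proof. by elim/forall_ord3: k; elim/forall_ord3: j. Qed.

Lemma det_mx33 (F : comNzRingType) (M : 'M[F]_3) :
  \det M = M 0 0 * (M 1 1 * M 2 2 - M 1 2 * M 2 1)
         - M 0 1 * (M 1 0 * M 2 2 - M 1 2 * M 2 0)
         + M 0 2 * (M 1 0 * M 2 1 - M 1 1 * M 2 0).
Proof.
(* Going through [inord] makes the indices plain numerals after [/=]. *)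
pose f m n := M (inord m) (inord n).
have ME i j : M i j = f i j by rewrite /f !inord_val.
rewrite (expand_det_row _ 0) !big_ord_recl big_ord0 /cofactor.
rewrite !(expand_det_row _ 0) !big_ord_recl !big_ord0 /cofactor.
rewrite !det_mx11 !mxE !ME /= /bump /=; ring.
Qed.

Lemma char_poly_ring_jacobian (F : comNzRingType) (a b : 'I_3 -> F) :
  char_poly (ring_jacobian a b) =
    ('X - (a 0)%:P) * ('X - (a 1)%:P) * ('X - (a 2)%:P)
      - (b 0 * b 1 * b 2)%:P.
Proof. rewrite /char_poly det_mx33 !mxE /= !rmorphM /=; ring. Qed.

Lemma complexify_ring_jacobian (R : rcfType) (a b : 'I_3 -> R) :
  complexify (ring_jacobian a b) =
  ring_jacobian (fun j => (a j)%:C) (fun j => (b j)%:C).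
Proof. by apply/matrixP => i j; rewrite !mxE; do 2?case: ifP. Qed.

Lemma mulmx_ring_jacobian (F : pzRingType) (a b : 'I_3 -> F) (u : 'cV[F]_3) j :
  (ring_jacobian a b *m u) j 0 = a j * u j 0 + b j * u (j + 1) 0.
Proof.
rewrite mxE (bigD1 j) //= (bigD1 (j + 1)) /=; last first.
  by elim/forall_ord3: j.
rewrite big1 => [|k /andP[/negPf kj /negPf kj1]].
  by rewrite !mxE eqxx addr0; congr (_ + _); case: eqP; elim/forall_ord3: j.
by rewrite mxE kj kj1 mul0r.
Qed.

Lemma ring_jacobian_hopf_det (R : rcfType) (a b : 'I_3 -> R) :
  hopf_spectrum (ring_jacobian a b) ->
  a 0 * a 1 + a 0 * a 2 + a 1 * a 2 = 1 ->
  a 0 * a 1 * a 2 + b 0 * b 1 * b 2 = a 0 + a 1 + a 2.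
Proof.
move=> [w w0]; rewrite eigenvalue_root_char complexify_ring_jacobian.
rewrite char_poly_ring_jacobian /root !hornerE => /eqP[re im] norm.
have w2 : w ^+ 2 = 1.
  (* Under the normalisation, the imaginary part of the characteristic polynomial at [i w] is
     [w (1 - w^2)]. *)
  apply/eqP; rewrite -subr_eq0; apply/eqP/(mulfI w0); rewrite mulr0.
  have : w * (a 0 * a 1 + a 0 * a 2 + a 1 * a 2) = w by rewrite norm mulr1.
  lra.
(* The real part equates [w^2 (a 0 + a 1 + a 2)] with [a 0 a 1 a 2 + b 0 b 1 b 2]. *)
have : w ^+ 2 * (a 0 + a 1 + a 2) = a 0 + a 1 + a 2 by rewrite w2 mul1r.
lra.
Qed.

Lemma expiD (R : realType) (s t : R) : expi (s + t) = expi s * expi t.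
Proof.
rewrite /expi cosD sinD; apply/eqP; rewrite eq_complex /=.
by apply/andP; split; apply/eqP; ring.
Qed.

Lemma expi0 (R : realType) : expi (0 : R) = 1.
Proof. by rewrite /expi cos0 sin0. Qed.

Lemma norm_expi (R : realType) (t : R) : `|expi t| = 1.
Proof. by rewrite normc_def /= cos2Dsin2 sqrtr1. Qed.

Lemma expi_neq0 (R : realType) (t : R) : expi t != 0.
Proof. by rewrite -normr_eq0 norm_expi oner_neq0. Qed.

Lemma expiN (R : realType) (t : R) : expi (- t) = (expi t)^-1.
Proof.
by apply: (mulIf (expi_neq0 _ t)); rewrite -expiD addNr expi0 mulVf ?expi_neq0.
Qed.

Lemma expi_int2pi (R : realType) (k : int) :
  expi (k%:~R * (2 * pi)) = 1 :> R[i].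
Proof.
have nat2pi n : expi (n%:R * (2 * pi)) = 1 :> R[i].
  elim: n => [|n IHn]; first by rewrite mul0r expi0.
  rewrite -natr1 mulrDl expiD IHn !mul1r -[2 * pi]add0r mulr_natl.
  by rewrite /expi cosD2pi sinD2pi cos0 sin0.
by case: (intP k) => [|n|n]; rewrite ?mul0r ?expi0 // ?mulrNz ?mulNr ?expiN
  nat2pi ?invr1.
Qed.

(** Subtracting [k] full turns brings [t] to [s] in [[0, 2 pi)]. Then [s] and [0] are both arguments
    of [1] in that range, so they agree by uniqueness. *)
Lemma expi_eq1 (R : realType) (t : R) : expi t = 1 -> eqmod2pi t 0.
Proof.
have pi0 : 0 < 2 * pi :> R by rewrite mulr_gt0 ?pi_gt0.
set k := Num.floor (t / (2 * pi)); pose s := t - k%:~R * (2 * pi).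
move=> t1; have s1 : expi s = 1.
  by rewrite expiD expiN expi_int2pi t1 invr1 mulr1.
have argC1 x : 0 <= x < 2 * pi -> expi x = 1 -> argC (1 : R[i]) = x.
  by move=> xI x1; apply: argC_uniq; rewrite ?oner_neq0 // x1 normr1 mulr1.
have sI : 0 <= s < 2 * pi.
  have := floor_itv (t / (2 * pi)).
  rewrite -/k intrD ler_pdivlMr // ltr_pdivrMr //
    [(k%:~R + _) * _]mulrDl mul1r => /andP[kt tk].
  by rewrite /s subr_ge0 kt ltrBlDl.
have s0 : s = 0 by rewrite -(argC1 s) // (argC1 0) ?lexx ?expi0.
by exists k; rewrite add0r; apply/eqP; rewrite -subr_eq0; apply/eqP.
Qed.

Lemma eqmod2piE (R : realType) (s t : R) : eqmod2pi s t <-> expi s = expi t.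
Proof.
split=> [[k ->]|st]; first by rewrite expiD expi_int2pi mulr1.
have [|k] := @expi_eq1 _ (s - t).
  by rewrite expiD expiN st divff ?expi_neq0.
by rewrite add0r => stk; exists k; rewrite -stk addrC subrK.
Qed.

(** Both sides amount to [expi theta] being the inverse of [expi (argC c)]: a shift by [theta]
    multiplies the eigenfunction by [expi (- theta)], which must be the unit part of [c]. *)
Lemma phase_shift_mulC (R : realType) n (u : 'cV[R[i]]_n) (j k : 'I_n)
    (c : R[i]) (theta : R) :
  c != 0 -> u j 0 != 0 -> u k 0 = c * u j 0 ->
  is_phase_shift (eigenfunction u j) (eigenfunction u k) theta <->
  eqmod2pi theta (2 * pi - argC c).
Proof.
move=> c0 uj0 ukE; have [_ cE] := argCP c0.
have expi2pi : expi (2 * pi) = 1 :> R[i] by rewrite -(expi_int2pi R 1) mul1r.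
rewrite eqmod2piE expiD expi2pi mul1r expiN; split=> [[r r0 /(_ 0)]|thetaE].
  (* Time [0] suffices: cancelling [u j 0] leaves [c = r / expi theta], whose modulus gives
     [r = |c|]. *)
  rewrite /eigenfunction ukE expi0 mul1r sub0r expiN mulrA => /(mulIf uj0) crE.
  have cr : `|c| = r%:C.
    by rewrite crE normrM normfV norm_expi invr1 mulr1 gtr0_norm // ltcR.
  apply: invr_inj; rewrite invrK.
  by apply: (@mulfI _ `|c|); rewrite ?normr_eq0 // -cE {1}cr -crE.
(* The modulus has type [R[i]], so the real amplitude is its real part. *)
have cR : `|c| = (complex.Re `|c|)%:C by rewrite normc_def.
exists (complex.Re `|c|) => [|t]; first by rewrite -ltcR -cR normr_gt0.
rewrite /eigenfunction ukE expiD expiN thetaE invrK -cR {1}cE; ring.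
Qed.

Theorem proposition3p8 (R : realType) (a b : 'I_3 -> R)
    (Hopf : hopf_spectrum (ring_jacobian a b))
    (normalised : a 0 * a 1 + a 0 * a 2 + a 1 * a 2 = 1) :
  [/\ char_poly (complexify (ring_jacobian a b)) =
        ('X - (a 0 + a 1 + a 2)%:C%:P) * ('X - 'i%C%:P) * ('X - (- 'i%C)%:P),
      forall j : 'I_3, b j != 0 &
      forall u : 'cV[R[i]]_3,
        is_eigenvector (complexify (ring_jacobian a b)) 'i%C u ->
        forall (j : 'I_3) (theta : R),
          is_phase_shift (eigenfunction u j) (eigenfunction u (j + 1)) theta <->
          eqmod2pi theta (2 * pi - argC (('i%C - (a j)%:C) / (b j)%:C))].
Proof.
have detE := ring_jacobian_hopf_det _ _ _ Hopf normalised.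
rewrite complexify_ring_jacobian.
have charE : char_poly (ring_jacobian (fun j => (a j)%:C) (fun j => (b j)%:C)) =
    ('X - (a 0 + a 1 + a 2)%:C%:P) * ('X - 'i%C%:P) * ('X - (- 'i%C)%:P).
  rewrite char_poly_ring_jacobian.
  have i2 : 'i%C%:P * 'i%C%:P = -1 :> {poly R[i]}.
    by rewrite -rmorphM /= -expr2 sqr_i rmorphN1.
  (* The normalisation is solved for the monomial [a 0 a 1], so that [ring] can use it as a
     rewriting rule alongside [i2]. *)
  have normP : (a 0)%:C%:P * (a 1)%:C%:P
      = 1 - (a 0)%:C%:P * (a 2)%:C%:P - (a 1)%:C%:P * (a 2)%:C%:P :> {poly R[i]}.
    by rewrite -!rmorphM -(rmorph1 polyC) -(rmorph1 (real_complex R)) -!rmorphB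
      -normalised /=; congr _%:C%:P; ring.
  have detP : ((b 0)%:C * (b 1)%:C * (b 2)%:C)%:P
      = (a 0)%:C%:P + (a 1)%:C%:P + (a 2)%:C%:P
        - (a 0)%:C%:P * (a 1)%:C%:P * (a 2)%:C%:P :> {poly R[i]}.
    by rewrite -!rmorphM -!rmorphD -!rmorphB -detE /=; congr _%:C%:P; ring.
  rewrite detP !rmorphD rmorphN /=; ring: i2 normP.
have ia_neq0 j : 'i%C - (a j)%:C != 0.
  by rewrite eq_complex /= subr0 oner_eq0 andbF.
have b_neq0 : forall j, b j != 0.
  have : b 0 * b 1 * b 2 != 0.
    (* Evaluating at [i] would make the product of the [i - a j] vanish, but each factor has
       imaginary part [1]. *)
    apply/eqP => b0.
    have := congr1 (horner^~ 'i%C) charE.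
    rewrite char_poly_ring_jacobian !hornerE.
    rewrite -!rmorphM b0 /= subrr mulr0 mul0r => /eqP.
    by rewrite subr0 !mulf_eq0 !(negPf (ia_neq0 _)).
  by rewrite !mulf_eq0 !negb_or -andbA => /and3P[? ? ?]; apply: forall_ord3.
split=> // u [u0 uE] j theta.
have bC_neq0 k : (b k)%:C != 0 :> R[i].
  by rewrite eq_complex /= eqxx andbT.
have c_neq0 k : ('i%C - (a k)%:C) / (b k)%:C != 0.
  by rewrite mulf_neq0 ?invr_eq0 ?ia_neq0.
have succE k : u (k + 1) 0 = ('i%C - (a k)%:C) / (b k)%:C * u k 0.
  have := congr1 (fun v : 'cV_3 => v k 0) uE.
  rewrite mulmx_ring_jacobian mxE => rowk.
  apply: (mulfI (bC_neq0 k)); rewrite mulrA mulrCA divff // mulr1 mulrBl -rowk.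
  ring.
(* It remains to see that [u j 0] is nonzero: otherwise the recurrence [succE] carries the zero
   around the ring and [u = 0]. *)
apply: phase_shift_mulC => //; apply: contra u0 => /eqP uj0.
have u1 : u (j + 1) 0 = 0 by rewrite succE uj0 mulr0.
have u2 : u (j + 1 + 1) 0 = 0 by rewrite succE u1 mulr0.
apply/eqP/colP => k; rewrite mxE.
by case/or3P: (ord3_cases j k) => /eqP->.
Qed.
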